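(* Let $R$ be a commutative ring with identity, let $S$ be a multiplicative subset of $R$, and suppose $R$ is $S$-Boolean (respectively, uniformly $S$-Boolean). Let $P$ be an $S$-primary ideal of $R$. Then $P$ is an $S$-maximal ideal of $R$, and hence $S$-prime.
   Context: A multiplicative subset contains $1$ and is closed under multiplication. An element $a\in R$ is $S$-idempotent with respect to $s\in S$ if $sa=a^2$, and $S$-idempotent if this holds for some $s\in S$. $R$ is $S$-Boolean if every element of $R$ is $S$-idempotent; $R$ is uniformly $S$-Boolean if there exists $s\in S$ such that every non-idempotent element of $R$ is $S$-idempotent with respect to $s$. For an ideal $P$ of $R$ with $P\cap S=\emptyset$: - $P$ is $S$-primary if there exists $s\in S$ such that for all $a,b\in R$ with $ab\in P$, either $sa\in P$ or $sb\in\mathrm{rad}(P)$ (the radical of $P$); - $P$ is $S$-prime if there exists $s\in S$ such that for all $a,b\in R$ with $ab\in P$, either $sa\in P$ or $sb\in P$; - $P$ is $S$-maximal if there exists $s\in S$ such that for every ideal $I\supseteq P$ of $R$, either $sI\subseteq P$ or $I\cap S\ne\emptyset$. *)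

(* Defs.v *)
From mathcomp Require Import all_boot all_algebra.
From mathcomp Require Import boolp classical_sets.

Set Implicit Arguments.
Unset Strict Implicit.
Unset Printing Implicit Defensive.

Import GRing.Theory.
Local Open Scope ring_scope.
Local Open Scope classical_set_scope.

Section SNotions.
Variable R : comPzRingType.
Implicit Types (S P I : set R) (s a b : R).

Definition multiplicative_subset S := GRing.mulr_closed (mem S).

(* MathComp's [idealr] only covers decidable proper ideals, while the ideals
   compared with an S-maximal ideal may be the whole ring; an ideal is
   therefore taken to be a submodule of the regular module [R^o]. *)
Definition is_ideal I := GRing.submod_closed (mem I : {pred R^o}).

Definition radical I : set R := [set x | exists2 n, (0 < n)%N & I (x ^+ n)].

Definition S_idempotent_wrt s a := s * a = a ^+ 2.

Definition S_idempotent S a := exists2 s, S s & S_idempotent_wrt s a.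

Definition S_boolean S := forall a, S_idempotent S a.

Definition uniformly_S_boolean S :=
  exists2 s, S s & forall a, a ^+ 2 <> a -> S_idempotent_wrt s a.

Definition S_primary S P :=
  [/\ is_ideal P, P `&` S = set0 &
      exists2 s, S s &
        forall a b, P (a * b) -> P (s * a) \/ radical P (s * b)].

Definition S_prime S P :=
  [/\ is_ideal P, P `&` S = set0 &
      exists2 s, S s &
        forall a b, P (a * b) -> P (s * a) \/ P (s * b)].

Definition S_maximal S P :=
  [/\ is_ideal P, P `&` S = set0 &
      exists2 s, S s &
        forall I, is_ideal I -> P `<=` I ->
          [set s * x | x in I] `<=` P \/ I `&` S !=set0].

End SNotions.

(* Main.v *)
(* If [t a = a^2] with [t] in [S], then [a (a - t) = 0] lies in [P], so with the
   constant [s] of the S-primary ideal [P] either [s a] is in [P] or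
   [s (a - t)] is in its radical. For [a] in an ideal [I] containing [P], the
   second alternative puts [(s t)^n] in [I]. For S-primeness, [t a = a^2] gives
   [a^n = t^(n-1) a], so [s a] in the radical of [P] makes an S-multiple of [a]
   lie in [P]; elements of [S] can be cancelled from it at the cost of the same
   constant [s], because no power of them lies in [P]. *)
Require Import Defs.
From mathcomp Require Import all_boot all_algebra.
From mathcomp Require Import boolp classical_sets.

Set Implicit Arguments.
Unset Strict Implicit.
Unset Printing Implicit Defensive.

Import GRing.Theory.
Local Open Scope ring_scope.
Local Open Scope classical_set_scope.

Section PrimaryBoolean.
Variable R : comPzRingType.
Implicit Types (S P I : set R) (s t a b : R).

Lemma multiplicative_subset1 S : multiplicative_subset S -> S 1.
Proof. by move=> [/[!in_setE]]. Qed.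

Lemma multiplicative_subsetM S a b :
  multiplicative_subset S -> S a -> S b -> S (a * b).
Proof.
by move=> [_ SM] Sa Sb; rewrite -in_setE; apply: SM; rewrite in_setE.
Qed.

Lemma multiplicative_subsetX S a n :
  multiplicative_subset S -> S a -> S (a ^+ n).
Proof.
move=> hS Sa; elim: n => [|n IHn]; first exact: multiplicative_subset1.
by rewrite exprS; apply: multiplicative_subsetM.
Qed.

Lemma ideal0 I : is_ideal I -> I 0.
Proof. by move=> [/[!in_setE]]. Qed.

Lemma idealMD I a b c : is_ideal I -> I b -> I c -> I (a * b + c).
Proof.
by move=> [_ IZ] Ib Ic; rewrite -in_setE; apply: (IZ a); rewrite in_setE.
Qed.

Lemma idealM I a b : is_ideal I -> I b -> I (a * b).
Proof.
by move=> hI Ib; rewrite -[a * b]addr0; apply: idealMD => //; apply: ideal0.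
Qed.

(** Idempotent elements take the constant [1], all others the uniform one. *)
Lemma uniformly_S_boolean_S_boolean S :
  multiplicative_subset S -> uniformly_S_boolean S -> S_boolean S.
Proof.
move=> hS [s Ss sP] a; have [a_idem|/sP] := pselect (a ^+ 2 = a); last by exists s.
by exists 1; [exact: multiplicative_subset1 | rewrite /S_idempotent_wrt mul1r].
Qed.

Lemma S_idempotent_wrt_expr s a n :
  S_idempotent_wrt s a -> a ^+ n.+1 = s ^+ n * a.
Proof.
move=> sa; elim: n => [|n IHn]; first by rewrite mul1r.
by rewrite exprSr IHn -mulrA -expr2 -sa mulrA -exprSr.
Qed.

(** Powers of an element of [S] stay in [S], so none of them can lie in [P]. *)
Lemma radical_disjoint S P :
  multiplicative_subset S -> P `&` S = set0 -> radical P `&` S = set0.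
Proof.
move=> hS PS0; rewrite -subset0 => a [[n _ Pan] Sa].
suff : set0 (a ^+ n) by [].
by rewrite -PS0; split=> //; apply: multiplicative_subsetX.
Qed.

Lemma S_primary_boolean_maximal S P : multiplicative_subset S ->
  S_boolean S -> S_primary S P -> S_maximal S P.
Proof.
move=> hS hB [hP PS0 [s Ss sP]]; split=> //; exists s => // I hI PI.
have [sIP|] := pselect ([set s * x | x in I] `<=` P); first by left.
move=> /existsNP[_ /not_implyP[[a Ia <-] nPsa]]; right.
have [t St ta] := hB a.
have Pa : P (a * (a - t)).
  by rewrite mulrBr -expr2 [a * t]mulrC ta subrr; apply: ideal0.
have [//|[n _ Pn]] := sP _ _ Pa.
exists ((s * t) ^+ n); split; last first.
  by apply: multiplicative_subsetX => //; apply: multiplicative_subsetM.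
(* [q] is the cofactor in [x^n - y^n = (x - y) q] for [x = s t] and [y = s (t - a)], where
   [x - y = s a]. The sign [(-1)^n] then turns [y^n] into the power of [s (a - t)] known to be in
   [P]. *)
set q := \sum_(i < n) (s * t) ^+ (n.-1 - i) * (s * (t - a)) ^+ i.
have -> : (s * t) ^+ n = q * s * a + (-1) ^+ n * (s * (a - t)) ^+ n.
  rewrite -exprMn mulN1r -mulrN opprB -[LHS](subrK ((s * (t - a)) ^+ n)).
  by rewrite subrXX -mulrBr subKr -/q mulrC mulrA.
by apply: idealMD => //; apply: idealM => //; apply: PI.
Qed.

Lemma S_primary_boolean_prime S P : multiplicative_subset S ->
  S_boolean S -> S_primary S P -> S_prime S P.
Proof.
move=> hS hB [hP PS0 [s Ss sP]]; split=> //; exists s => // a b Pab.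
have [|[[//|n] _]] := sP _ _ Pab; first by left.
have [t St tb] := hB b.
(* The power of [s b] in [P] becomes [b u] with [u = s^(n+1) t^n] in [S]. Applying [sP] again, to
   this product, gives either the goal or [s u] in the radical of [P], which is impossible as [s u]
   is in [S]. *)
rewrite exprMn (S_idempotent_wrt_expr _ tb) mulrA mulrC => Pbu; right.
have [//|rad_su] := sP _ _ Pbu.
suff : set0 (s * (s ^+ n.+1 * t ^+ n)) by [].
rewrite -(radical_disjoint hS PS0); split=> //.
by do 2![apply: multiplicative_subsetM => //]; apply: multiplicative_subsetX.
Qed.

End PrimaryBoolean.

Theorem theorem3p12 (R : comPzRingType) (S : set R)
    (hS : multiplicative_subset S) (P : set R) (hP : S_primary S P) :
  (S_boolean S -> S_maximal S P /\ S_prime S P) /\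
  (uniformly_S_boolean S -> S_maximal S P /\ S_prime S P).
Proof.
have main : S_boolean S -> S_maximal S P /\ S_prime S P.
  by move=> hB; split;
    [exact: S_primary_boolean_maximal | exact: S_primary_boolean_prime].
by split=> // /(uniformly_S_boolean_S_boolean hS).
Qed.
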